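(* Let $L\in \mathbb{N}$ with $L\geq 3$, let $d,B\in \mathbb{N}$, $p,q\in [1,\infty]$, and $c\in (0,\infty)$. Suppose that the target class $U\subset C([0,1]^d)$ contains a copy of $\mathcal{H}_{(d,B,\dots , B,1),c}^q$ with constant $c_0>0$, where $B$ appears $L-1$ times in $(d,B,\dots,B,1)$; that is, there is $u_0\in U$ with $u_0+c_0\cdot \mathcal{H}_{(d,B,\dots , B,1),c}^q\subset U$. Then for every $m\in\mathbb{N}$ and every $s\in \mathbb{N}$ with $s\le \min\{\frac{B}{3},d\}$, \[ \mathrm{err}_m^{MC}(U,L^p([0,1]^d)) \geq c_0\cdot \frac{\Omega}{(64s)^{1+\frac{s}{p}}}\cdot m^{-\frac{1}{p} - \frac{1}{s}}, \] where \[ \Omega = \begin{cases} \frac{1}{4 \cdot 3^{2/q}} \cdot c^L \cdot s^{1-\frac{2}{q}} & \text{if } q\le 2, \\ \frac{1}{24} \cdot c^L\cdot (B^{1-\frac{2}{q}})^{L-1} & \text{if } q\geq 2 .\end{cases} \] (Here $1/p=0$ and $2/q=0$ when $p=\infty$, resp. $q=\infty$.)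
   Context: ReLU: $\varrho(x)=\max\{0,x\}$, applied componentwise to vectors. For an architecture $(N_0,\dots,N_L)\in\mathbb{N}^{L+1}$ and coefficients $\Phi=((W^i,b^i))_{i=1}^L$ with $W^i\in\mathbb{R}^{N_i\times N_{i-1}}$, $b^i\in\mathbb{R}^{N_i}$, the realization $R(\Phi):\mathbb{R}^{N_0}\to\mathbb{R}^{N_L}$ is $R(\Phi)(x)=x^L$ where $x^0=x$, $x^i=\varrho(W^ix^{i-1}+b^i)$ for $i\in\{1,\dots,L-1\}$, and $x^L=W^Lx^{L-1}+b^L$. For a matrix or vector, $\|\cdot\|_{\ell^q}$ is the $\ell^q$ norm of its entries (max of absolute values for $q=\infty$), and $\|\Phi\|_{\ell^q}=\max_{1\le i\le L}\max\{\|W^i\|_{\ell^q},\|b^i\|_{\ell^q}\}$. Define $\mathcal{H}^q_{(N_0,\dots,N_L),c}=\{R(\Phi): \|\Phi\|_{\ell^q}\le c\}$ (functions restricted to $[0,1]^d$ where relevant). Algorithms: Let $Y$ be a Banach space and $U\subset C([0,1]^d)\cap Y$. A map $A:U\to Y$ is an adaptive deterministic method using $m$ point samples if there are $f_1\in[0,1]^d$, maps $f_i:([0,1]^d)^{i-1}\times\mathbb{R}^{i-1}\to[0,1]^d$ ($i=2,\dots,m$) and $Q:([0,1]^d)^m\times\mathbb{R}^m\to Y$ such that for every $u\in U$, with $x_1=f_1$ and $x_i=f_i(x_1,\dots,x_{i-1},u(x_1),\dots,u(x_{i-1}))$, one has $A(u)=Q(x_1,\dots,x_m,u(x_1),\dots,u(x_m))$;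 the set of these is $\mathrm{Alg}_m(U,Y)$. An adaptive random method using $m$ point samples on average is a pair $(\mathbf{A},\mathbf{m})$ with $\mathbf{A}=(A_\omega)_{\omega\in\Omega}$ over a probability space $(\Omega,\mathcal{F},\mathbb{P})$ and $\mathbf{m}:\Omega\to\mathbb{N}$ measurable with $\mathbb{E}[\mathbf{m}]\le m$, such that $\omega\mapsto A_\omega(u)$ is Borel measurable for every $u\in U$ and $A_\omega\in\mathrm{Alg}_{\mathbf{m}(\omega)}(U,Y)$ for every $\omega$; the set of these is $\mathrm{Alg}^{MC}_m(U,Y)$. The optimal randomized error is $\mathrm{err}^{MC}_m(U,Y)=\inf_{(\mathbf{A},\mathbf{m})\in\mathrm{Alg}^{MC}_m(U,Y)}\sup_{u\in U}\mathbb{E}[\|u-A_\omega(u)\|_Y]$. *)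

(* Defs.v *)
From HB Require Import structures.
From mathcomp Require Import all_boot all_order all_algebra.
From mathcomp Require Import all_classical all_reals all_analysis.
Set Implicit Arguments. Unset Strict Implicit. Unset Printing Implicit Defensive.
Import Order.TTheory GRing.Theory Num.Theory.
Local Open Scope classical_set_scope.
Local Open Scope ring_scope.

Section Defs.
Variable R : realType.

Definition relu (x : R) : R := Num.max 0 x.

(* hidden states x^0,...,x^k for widths N 0, N 1, ...; W i, b i are the
   coefficients of layer i+1 *)
Fixpoint hidden (N : nat -> nat) (W : forall i, 'M[R]_(N i.+1, N i))
  (b : forall i, 'cV[R]_(N i.+1)) (x : 'cV[R]_(N 0)) (k : nat) : 'cV[R]_(N k) :=
  match k as k0 return 'cV[R]_(N k0) with
  | 0 => x
  | k'.+1 => map_mx relu (W k' *m hidden W b x k' + b k')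
  end.

(* realization of a network of architecture (N 0, ..., N (L-1), 1):
   layers 1..L-1 are (W i, b i) for i < L-1, the last (affine) layer is (WL, bL) *)
Definition realize (N : nat -> nat) (L : nat) (W : forall i, 'M[R]_(N i.+1, N i))
  (b : forall i, 'cV[R]_(N i.+1)) (WL : 'M[R]_(1, N L.-1)) (bL : 'cV[R]_1)
  (x : 'cV[R]_(N 0)) : R :=
  (WL *m hidden W b x L.-1 + bL) ord0 ord0.

Definition lqnorm (q : \bar R) m n (A : 'M[R]_(m, n)) : R :=
  match q with
  | r%:E => (\sum_(i < m) \sum_(j < n) `|A i j| `^ r) `^ r^-1
  | _ => \big[Num.max/0]_(i < m) \big[Num.max/0]_(j < n) `|A i j|
  end.

Definition netnorm (q : \bar R) (N : nat -> nat) (L : nat)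
  (W : forall i, 'M[R]_(N i.+1, N i)) (b : forall i, 'cV[R]_(N i.+1))
  (WL : 'M[R]_(1, N L.-1)) (bL : 'cV[R]_1) : R :=
  Num.max (\big[Num.max/0]_(i < L.-1) Num.max (lqnorm q (W i)) (lqnorm q (b i)))
          (Num.max (lqnorm q WL) (lqnorm q bL)).

Definition archDB (d B : nat) : nat -> nat := fun i => if i is 0 then d else B.

Definition tcol d (x : d.-tuple R) : 'cV[R]_d := \col_i tnth x i.

Definition cube d : set (d.-tuple R) := [set x | forall i, 0 <= tnth x i <= 1].

(* H^q_{(d,B,...,B,1),c}, as functions on R^d (only values on [0,1]^d matter) *)
Definition Hclass (q : \bar R) (d B L : nat) (c : R) : set (d.-tuple R -> R) :=
  [set f | exists (W : forall i, 'M[R]_(archDB d B i.+1, archDB d B i))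
              (b : forall i, 'cV[R]_(archDB d B i.+1))
              (WL : 'M[R]_(1, archDB d B L.-1)) (bL : 'cV[R]_1),
     netnorm q W b WL bL <= c /\
     f = fun x => realize W b WL bL (tcol x)].

Definition cont_on_cube d (u : d.-tuple R -> R) : Prop :=
  forall x, cube x -> forall e : R, 0 < e ->
    exists2 del : R, 0 < del & forall y, cube y ->
      (forall i, `|tnth x i - tnth y i| < del) -> `|u x - u y| < e.

(* d-dimensional Lebesgue measure (on the product Borel sigma-algebra of
   d.-tuple R): the measure of every closed box is its volume *)
Definition is_lebesgue d (lam : {measure set (d.-tuple R) -> \bar R}) : Prop :=
  forall a b : d.-tuple R, (forall i, tnth a i <= tnth b i) ->
    lam [set x | forall i, tnth a i <= tnth x i <= tnth b i] =
    (\prod_(i < d) (tnth b i - tnth a i))%:E.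

Definition Lpnorm d (lam : {measure set (d.-tuple R) -> \bar R}) (p : \bar R)
  (f : d.-tuple R -> R) : \bar R :=
  Lnorm lam p (fun x => (f x * \1_(@cube d) x)%:E).

Definition Yset d (lam : {measure set (d.-tuple R) -> \bar R}) (p : \bar R)
  : set (d.-tuple R -> R) :=
  [set f | measurable_fun (@cube d) f /\ (Lpnorm lam p f < +oo)%E].

(* open subsets of Y for the (pseudo)metric ||f - g||_{L^p}; a map into Y is
   Borel measurable iff preimages of these sets are measurable *)
Definition Yopen d (lam : {measure set (d.-tuple R) -> \bar R}) (p : \bar R)
  (O : set (d.-tuple R -> R)) : Prop :=
  O `<=` Yset lam p /\
  forall f, O f -> exists2 r : R, 0 < r & forall g, Yset lam p g ->
    (Lpnorm lam p (g \- f)%R < r%:E)%E -> O g.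

Fixpoint hist d (next : seq (d.-tuple R * R) -> d.-tuple R)
  (u : d.-tuple R -> R) (k : nat) : seq (d.-tuple R * R) :=
  match k with
  | 0 => [::]
  | k'.+1 => let h := hist next u k' in rcons h (next h, u (next h))
  end.

(* the set of values sup_{u in U} E[||u - A_w(u)||_Y] over all
   (A, m) in Alg^MC_m(U, Y); A_w is given by (next w, Q w) using mm w samples:
   A_w(u) = Q w (hist (next w) u (mm w)) *)
Definition MCerrors d (lam : {measure set (d.-tuple R) -> \bar R}) (p : \bar R)
  (U : set (d.-tuple R -> R)) (m : nat) : set (\bar R) :=
  [set e | exists (dO : measure_display) (Om : measurableType dO)
      (P : probability Om R)
      (next : Om -> seq (d.-tuple R * R) -> d.-tuple R)
      (Q : Om -> seq (d.-tuple R * R) -> (d.-tuple R -> R))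
      (mm : Om -> nat),
    measurable_fun [set: Om] mm /\
        (\int[P]_w ((mm w)%:R)%:E <= (m%:R)%:E)%E /\
        (forall w, (0 < mm w)%N) /\
        (forall w h, @cube d (next w h)) /\
        (forall w h, Yset lam p (Q w h)) /\
        (forall u, U u -> forall O, Yopen lam p O ->
           measurable [set w | O (Q w (hist (next w) u (mm w)))]) /\
        e = ereal_sup [set (\int[P]_w Lpnorm lam p (u \- Q w (hist (next w) u (mm w)))%R)%E
                       | u in U]].

Definition errMC d (lam : {measure set (d.-tuple R) -> \bar R}) (p : \bar R)
  (U : set (d.-tuple R -> R)) (m : nat) : \bar R :=
  ereal_inf (MCerrors lam p U m).

Definition einv (p : \bar R) : R := if p is r%:E then r^-1 else 0.

End Defs.
Arguments cube {R} d.
Arguments Hclass {R} q d B L c.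

(* Main.v *)
(* Fooling argument.  On the first [s] coordinates place [k ^ s >= 2 m] pyramids
   [max(0, h - |x - y|_1)] of radius [h = 1 / (2 k)] with disjoint supports.  A
   multiple [G] of each pyramid and its negative lie in the network class: the
   first layer computes (copies of) [relu (x_i - y_i)], [relu (y_i - x_i)] and
   [h / s], the second layer combines them, and the later layers only amplify.
   On a given run with [n] samples along [u0], at most [n] pyramids are seen;
   for every other one, the perturbations [u0 + c0 G pyr] and [u0 - c0 G pyr]
   produce the same output, which is far from one of the two.  Averaging over all
   the signed pyramids and over the randomness gives the bound. *)

Require Import Defs.
From HB Require Import structures.
From mathcomp Require Import all_boot all_order all_algebra.
From mathcomp Require Import all_classical all_reals all_analysis.
From mathcomp Require Import measurable_realfun ess_sup_inf zify ring lra.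
Import Order.TTheory GRing.Theory Num.Theory.
Local Open Scope classical_set_scope.
Local Open Scope ring_scope.

(** * Block sums and entrywise norms of sparse matrices *)

Lemma sum_nat_blocks (V : nmodType) (n k : nat) (F : nat -> V) :
  \sum_(0 <= a < n * k) F a =
  \sum_(0 <= j < n) \sum_(0 <= i < k) F (j * k + i)%N.
Proof.
rewrite big_nat_mul; apply: eq_bigr => j _.
by rewrite mulSn -{1}[(j * k)%N]add0n big_addn addnK; apply: eq_bigr => i _; rewrite addnC.
Qed.

Lemma sum_ord_trunc (V : nmodType) (n B : nat) (F : nat -> V) : (n <= B)%N ->
  \sum_(a < B) (if (a < n)%N then F a else 0) = \sum_(0 <= a < n) F a.
Proof. by move=> nB; rewrite big_mkord (big_ord_widen _ _ nB) [RHS]big_mkcond. Qed.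

Section LqNorm.
Variable R : realType.
Implicit Types (q : \bar R).

Lemma einv_ge0 q : (1 <= q)%E -> 0 <= einv q.
Proof.
by case: q => //= r; rewrite lee_fin => r1; rewrite invr_ge0 (le_trans _ r1).
Qed.

(** Only places in [S] can carry a nonzero entry, and there are at most [K] of them, each of size at
    most [a]. For infinite [q] the factor is [K ^ 0 = 1], also when [K = 0]. *)
Lemma lqnorm_le q m n (A : 'M[R]_(m, n)) (a : R) (S : nat -> nat -> bool) (K : nat) :
  (1 <= q)%E -> 0 <= a ->
  (forall i j, `|A i j| <= if S i j then a else 0) ->
  (\sum_(i < m) \sum_(j < n) S i j <= K)%N ->
  lqnorm q A <= a * K%:R `^ einv q.
Proof.
move=> q1 a0 HA HK; case: q q1 => //= [r|_]; last first.
  rewrite powRr0 mulr1; apply: bigmax_le => // i _; apply: bigmax_le => // j _.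
  by apply: le_trans (HA i j) _; case: ifP.
rewrite lee_fin => r1; have r0 : 0 < r by apply: lt_le_trans r1.
have -> : a * K%:R `^ r^-1 = (a `^ r * K%:R) `^ r^-1.
  by rewrite powRM ?powR_ge0// -powRrM mulfV ?gt_eqF// powRr1.
apply: ge0_ler_powR; rewrite ?nnegrE ?invr_ge0 ?(ltW r0)//.
- by apply: sumr_ge0 => i _; apply: sumr_ge0 => j _; exact: powR_ge0.
- by rewrite mulr_ge0// powR_ge0.
apply: (@le_trans _ _ (\sum_(i < m) \sum_(j < n) a `^ r * (S i j)%:R)).
  apply: ler_sum => i _; apply: ler_sum => j _.
  apply: le_trans (_ : (if S i j then a else 0) `^ r <= _).
    apply: ge0_ler_powR; rewrite ?nnegrE ?(ltW r0)//.
    by case: ifP.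
  by case: (S i j); rewrite ?mulr1// powR0 ?gt_eqF// mulr0.
under eq_bigr do rewrite -mulr_sumr -natr_sum.
rewrite -mulr_sumr -natr_sum; apply: ler_wpM2l; first exact: powR_ge0.
by rewrite ler_nat.
Qed.

End LqNorm.

(** * A ReLU network computing a multiple of a pyramid *)

Definition pyramid {R : realType} {d : nat} (s : nat) (h : R) (y : nat -> R)
    (x : d.-tuple R) : R :=
  relu (h - \sum_(0 <= i < s) `|x`_i - y i|).

Section BumpNetwork.
Variables (R : realType) (d B s r n : nat) (h al be ga eta : R) (y : nat -> R).
Hypotheses (s0 : (0 < s)%N) (sd : (s <= d)%N) (KB : (3 * r * s <= B)%N)
  (nB : (n <= B)%N).

(* Hidden unit [j * s + i] of the first layer computes a multiple of
   [x_i - y_i], [y_i - x_i] or [h / s], according to [j %% 3]. *)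
Let sgn1 (t : nat) : R := nth 0 [:: 1; -1] t.
Let sgn2 (t : nat) : R := nth 0 [:: -1; -1; 1] t.

(** Weights vanish outside an active block of [3 * r * s] units in layer one and [n] units
    afterwards. The layers keep width [B], but only the block sizes enter the norm. *)
Let w (l a b : nat) : R := match l with
  | 0 => if (a < 3 * r * s)%N && (b == a %% s)%N
         then al * sgn1 ((a %/ s) %% 3) else 0
  | 1 => if (a < n)%N && (b < 3 * r * s)%N then be * sgn2 ((b %/ s) %% 3) else 0
  | _ => if (a < n)%N && (b < n)%N then ga else 0
  end.

Let v (l a : nat) : R := match l with
  | 0 => if (a < 3 * r * s)%N
         then al * nth 0 [:: - y (a %% s)%N; y (a %% s)%N; h / s%:R] ((a %/ s) %% 3)
         else 0
  | _ => 0
  end.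

Let W (l : nat) : 'M[R]_(archDB d B l.+1, archDB d B l) := \matrix_(a, b) w l a b.
Let b (l : nat) : 'cV[R]_(archDB d B l.+1) := \col_a v l a.
Let WL (l : nat) : 'M[R]_(1, archDB d B l) := \matrix_(a, b) if (b < n)%N then eta else 0.
Let bL : 'cV[R]_1 := 0.

Let relu_ge0 (x : R) : 0 <= relu x.
Proof. by rewrite /relu le_max lexx. Qed.

Let relu_id (x : R) : 0 <= x -> relu x = x.
Proof. by rewrite /relu; case: (leP 0 x). Qed.

Let relu_pM (a x : R) : 0 <= a -> relu (a * x) = a * relu x.
Proof. by move=> a0; rewrite /relu maxr_pMr// mulr0. Qed.

Let relu0 : relu (0 : R) = 0.
Proof. exact: relu_id. Qed.

Let reluDN (x : R) : relu x + relu (- x) = `|x|.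
Proof.
rewrite /relu; case: (lerP 0 x) => x0.
  by rewrite ger0_norm// max_l ?addr0// oppr_le0.
by rewrite ltr0_norm// max_r ?add0r// oppr_ge0 ltW.
Qed.

Hypotheses (h0 : 0 <= h) (al0 : 0 <= al) (be0 : 0 <= be) (ga0 : 0 <= ga).

Lemma hidden1E (x : d.-tuple R) (a : 'I_(archDB d B 1)) :
  hidden W b (tcol x) 1 a 0 = if (a < 3 * r * s)%N then
    al * relu (nth 0 [:: x`_(a %% s) - y (a %% s); y (a %% s) - x`_(a %% s); h / s%:R]
               ((a %/ s) %% 3)) else 0.
Proof.
rewrite /= !mxE /=; case: ifPn => [aK|aK]; last first.
  by rewrite big1 ?add0r// => j _; rewrite !mxE /= (negbTE aK) mul0r.
have id : (a %% s < d)%N by apply: leq_trans sd; rewrite ltn_mod.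
rewrite (bigD1 (Ordinal id))//= !mxE /= aK eqxx /= big1 ?addr0; last first.
  move=> j /negP jn; rewrite !mxE /= aK /=; case: eqP => [e|]; last by rewrite mul0r.
  by case: jn; apply/eqP/val_inj.
rewrite (tnth_nth 0) /= -relu_pM//; congr relu.
rewrite /sgn1; have : ((a %/ s) %% 3 < 3)%N by rewrite ltn_mod.
case: ((a %/ s) %% 3)%N => [|[|[|//]]] _ /=; ring.
Qed.

(** Layer one consists of [r] groups of [3 * s] active units. In each group,
    [relu t + relu (- t) = |t|] turns the two signed families into the l^1 distance to [y], and the
    [s] constant units add up to [h]; [sgn2] supplies the signs. *)
Lemma hidden2E (x : d.-tuple R) (a : 'I_(archDB d B 2)) :
  hidden W b (tcol x) 2 a 0 =
  if (a < n)%N then al * be * r%:R * pyramid s h y x else 0.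
Proof.
rewrite [hidden _ _ _ _]/= mxE mxE [X in _ + X]mxE /= addr0 mxE.
case: ifPn => an; last first.
  rewrite big1 ?relu0// => j _; rewrite !mxE /= (negbTE an) mul0r//.
rewrite /pyramid -relu_pM ?mulr_ge0//; congr relu.
pose F (a : nat) := be * sgn2 ((a %/ s) %% 3) *
  (al * relu (nth 0 [:: x`_(a %% s) - y (a %% s); y (a %% s) - x`_(a %% s); h / s%:R]
               ((a %/ s) %% 3))).
transitivity (\sum_(j < B) if (j < 3 * r * s)%N then F j else 0).
  apply: eq_bigr => j _; rewrite -[map_mx _ _]/(hidden W b (tcol x) 1) hidden1E !mxE /= an /=.
  by case: ifP => // _; rewrite mul0r.
(* The unit index is split as [j * (3 * s) + (t * s + i)]: group [j], kind [t], coordinate [i].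
   Division and remainder by [s] then recover [t] modulo 3 and [i]. *)
rewrite sum_ord_trunc// (_ : 3 * r * s = r * (3 * s))%N; last by rewrite mulnA (mulnC r).
rewrite sum_nat_blocks.
transitivity (\sum_(0 <= j < r) al * be * (h - \sum_(0 <= i < s) `|x`_i - y i|)); last first.
  by rewrite sumr_const_nat subn0 -mulr_natr; ring.
apply: eq_bigr => j _; rewrite sum_nat_blocks.
rewrite (_ : index_iota 0 3 = [:: 0; 1; 2]%N)// !big_cons big_nil addr0.
have E t : (t < 3)%N -> \sum_(0 <= i < s) F (j * (3 * s) + (t * s + i))%N = al * be * sgn2 t *
   \sum_(0 <= i < s) relu (nth 0 [:: x`_i - y i; y i - x`_i; h / s%:R] t).
  move=> t3; rewrite mulr_sumr; apply: eq_big_nat => i /andP[_ is_].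
  rewrite mulnA addnA -mulnDl /F divnMDl// (divn_small is_) addn0 modnMDl (modn_small t3).
  by rewrite modnMDl (modn_small is_); ring.
rewrite !E//= /sgn2/=.
have -> : \sum_(0 <= i < s) relu (h / s%:R) = h.
  rewrite sumr_const_nat subn0 relu_id ?divr_ge0// -(mulr_natr (h / _)) divfK//.
  by rewrite pnatr_eq0 -lt0n.
have -> : \sum_(0 <= i < s) `|x`_i - y i| =
  \sum_(0 <= i < s) relu (x`_i - y i) + \sum_(0 <= i < s) relu (y i - x`_i).
  by rewrite -big_split; apply: eq_bigr => i _ /=; rewrite -reluDN opprB.
ring.
Qed.

(** From layer two on, all [n] active units carry one common nonnegative value, on which [relu] acts
    as the identity. Each further layer therefore multiplies it by [n * ga]. *)
Lemma hiddenE (x : d.-tuple R) (l : nat) (a : 'I_(archDB d B l.+2)) :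
  hidden W b (tcol x) l.+2 a 0 =
  if (a < n)%N then (n%:R * ga) ^+ l * (al * be * r%:R) * pyramid s h y x else 0.
Proof.
elim: l a => [|l IH] a; first by rewrite hidden2E expr0 mul1r.
rewrite [hidden _ _ _ _]/= mxE mxE [X in _ + X]mxE /= addr0 mxE.
case: ifPn => an; last first.
  rewrite big1 ?relu0// => j _; rewrite !mxE /= (negbTE an) mul0r//.
transitivity (relu (\sum_(j < B) if (j < n)%N then
   ga * ((n%:R * ga) ^+ l * (al * be * r%:R) * pyramid s h y x) else 0)).
  congr relu; apply: eq_bigr => j _.
  rewrite -[map_mx _ _]/(hidden W b (tcol x) l.+2) IH !mxE /= an /=.
  by case: ifP => // _; rewrite mul0r.
rewrite (sum_ord_trunc _ _ _
  (fun=> ga * ((n%:R * ga) ^+ l * (al * be * r%:R) * pyramid s h y x)) nB).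
rewrite sumr_const_nat subn0 relu_id.
  by rewrite -mulr_natr exprS; ring.
by rewrite mulrn_wge0// !mulr_ge0// ?relu_ge0// exprn_ge0 ?mulr_ge0.
Qed.

(** No [relu] follows the output layer, so [eta] may be negative; this is the source of the negative
    pyramids. *)
Lemma realizeE (x : d.-tuple R) (l : nat) :
  realize W b (WL (l.+3).-1) bL (tcol x) =
  eta * n%:R * ((n%:R * ga) ^+ l * (al * be * r%:R)) * pyramid s h y x.
Proof.
rewrite /realize mxE [X in _ + X]mxE addr0 mxE.
transitivity (\sum_(j < B) if (j < n)%N then
   eta * ((n%:R * ga) ^+ l * (al * be * r%:R) * pyramid s h y x) else 0).
  apply: eq_bigr => j _; rewrite hiddenE !mxE.
  by case: ifP => // _; rewrite mul0r.
rewrite (sum_ord_trunc _ _ _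
  (fun=> eta * ((n%:R * ga) ^+ l * (al * be * r%:R) * pyramid s h y x)) nB).
by rewrite sumr_const_nat subn0 -mulr_natr; ring.
Qed.

Variables (q : \bar R) (c : R).
Hypotheses (q1 : (1 <= q)%E) (c0 : 0 <= c) (h1 : h <= 1)
  (y01 : forall i, (i < s)%N -> 0 <= y i <= 1).
Variable K : nat.
Hypothesis rK : (3 * r * s <= K)%N.
Hypotheses (HA : al * K%:R `^ einv q <= c)
  (HB : be * (n * K)%:R `^ einv q <= c)
  (HG : ga * (n * n)%:R `^ einv q <= c)
  (HE : `|eta| * n%:R `^ einv q <= c).

Let sum_trunc (N M : nat) : (\sum_(i < N) (i < M) <= M)%N.
Proof.
suff -> : (\sum_(i < N) (i < M) = minn N M)%N by exact: geq_minr.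
elim: N => [|N IH]; first by rewrite big_ord0 min0n.
rewrite big_ord_recr/= IH; case: ltnP => NM.
  by rewrite (minn_idPl NM) addn1.
by rewrite (minn_idPr (leqW NM)) addn0.
Qed.

Let sum_trunc2 (N N' M M' : nat) :
  (\sum_(i < N) \sum_(j < N') ((i < M) && (j < M')) <= M * M')%N.
Proof.
apply: (@leq_trans (\sum_(i < N) (i < M) * M')%N);
  last by rewrite -big_distrl /= leq_mul2r sum_trunc orbT.
apply: leq_sum => i _; case: (i < M)%N => /=; first by rewrite mul1n sum_trunc.
by rewrite big1.
Qed.

(** First-layer weights have at most one nonzero entry per row, so the count does not grow with the
    input dimension. *)
Let sum_diag (N N' M : nat) (f : nat -> nat) :
  (\sum_(i < N) \sum_(j < N') ((i < M) && (j == f i :> nat)) <= M)%N.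
Proof.
apply: leq_trans (sum_trunc N M); apply: leq_sum => i _.
case: (i < M)%N => /=; last by rewrite big1.
have [fi|fi] := ltnP (f i) N'.
  by rewrite (bigD1 (Ordinal fi))//= eqxx big1// => j jn; apply/eqP; rewrite eqb0.
by rewrite big1// => j _; apply/eqP; rewrite eqb0 neq_ltn (leq_trans (ltn_ord j) fi).
Qed.

(** Each of [HA], [HB], [HG], [HE] is [lqnorm_le] for the support of one kind of layer. The
    first-layer biases stay below [al] because [y i] lies in [0,1] and [h / s <= 1]. *)
Lemma netnorm_le (l : nat) : netnorm q W b (WL (l.+3).-1) bL <= c.
Proof.
have lq N N' (A : 'M[R]_(N, N')) e (S : nat -> nat -> bool) k : e * k%:R `^ einv q <= c ->
  0 <= e -> (forall i j, `|A i j| <= if S i j then e else 0) ->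
  (\sum_(i < N) \sum_(j < N') S i j <= k)%N -> lqnorm q A <= c.
  by move=> ec e0 HS Hk; apply: le_trans ec; exact: lqnorm_le HS Hk.
have al_mono : al * (3 * r * s)%:R `^ einv q <= c.
  apply: le_trans HA; apply: ler_wpM2l => //; apply: ge0_ler_powR; rewrite ?nnegrE//.
    exact: einv_ge0.
  by rewrite ler_nat.
have be_mono : be * (n * (3 * r * s))%:R `^ einv q <= c.
  apply: le_trans HB; apply: ler_wpM2l => //; apply: ge0_ler_powR; rewrite ?nnegrE//.
    exact: einv_ge0.
  by rewrite ler_nat leq_mul2l rK orbT.
have z N : lqnorm q (0 : 'cV[R]_N) <= c.
  apply: (lq _ _ _ 0 (fun _ _ => false) 0%N); rewrite ?mul0r//.
    by move=> i j; rewrite mxE normr0.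
  by rewrite big1// => i _; rewrite big1.
rewrite /netnorm ge_max; apply/andP; split; last first.
  rewrite ge_max; apply/andP; split => //.
  apply: (lq _ _ _ `|eta| (fun i j => (i < 1)%N && (j < n)%N) n) => //.
    move=> i j; rewrite mxE /= [i]ord1 /=.
    by case: ifP; rewrite ?normr0.
  by apply: leq_trans (sum_trunc2 _ _ _ _) _; rewrite mul1n.
apply: bigmax_le => // i0 _; case: (nat_of_ord i0) => [|[|k]];
  rewrite ge_max; apply/andP; split => //=.
- apply: (lq _ _ _ al (fun i j => (i < 3 * r * s)%N && (j == i %% s)%N) (3 * r * s)%N) => //.
    move=> i j; rewrite mxE /=; case: ifP => _; rewrite ?normr0//.
    rewrite normrM ger0_norm// ler_piMr// /sgn1.
    by case: (_ %% 3)%N => [|[|t]]/=; rewrite ?nth_nil ?normrN ?normr1 ?normr0.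
  exact: (sum_diag _ _ _ (fun i => i %% s)%N).
- apply: (lq _ _ _ al (fun i j => (i < 3 * r * s)%N && (j < 1)%N) (3 * r * s)%N) => //.
    move=> i j; rewrite mxE /= [j]ord1 andbT; case: ifP => _; rewrite ?normr0//.
    rewrite normrM (ger0_norm al0) ler_piMr//.
    have /y01/andP[yi0 yi1] : (i %% s < s)%N by rewrite ltn_mod.
    case: (_ %% 3)%N => [|[|[|t]]]/=; rewrite ?nth_nil ?normr0// ?normrN ger0_norm ?divr_ge0//.
    by rewrite ler_pdivrMr ?ltr0n// mul1r (le_trans h1)// ler1n.
  by apply: leq_trans (sum_trunc2 _ _ _ _) _; rewrite muln1.
- apply: (lq _ _ _ be (fun i j => (i < n)%N && (j < 3 * r * s)%N) (n * (3 * r * s))%N) => //.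
    move=> i j; rewrite mxE /=; case: ifP => _; rewrite ?normr0//.
    rewrite normrM (ger0_norm be0) ler_piMr// /sgn2.
    by case: (_ %% 3)%N => [|[|[|t]]]/=; rewrite ?nth_nil ?normrN ?normr1 ?normr0.
- suff -> : b 1 = 0 by exact: z.
  by apply/matrixP => i j; rewrite !mxE.
- apply: (lq _ _ _ ga (fun i j => (i < n)%N && (j < n)%N) (n * n)%N) => //.
  by move=> i' j; rewrite mxE /=; case: ifP => _; rewrite ?normr0 ?ger0_norm.
- suff -> : b k.+2 = 0 by exact: z.
  by apply/matrixP => i' j; rewrite !mxE.
Qed.

Lemma Hclass_bump (l : nat) : Hclass q d B l.+3 c
  (fun x => eta * n%:R * ((n%:R * ga) ^+ l * (al * be * r%:R)) * pyramid s h y x).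
Proof.
exists W, b, (WL (l.+3).-1), bL; split; first exact: netnorm_le.
by apply/funext => x; rewrite realizeE.
Qed.

End BumpNetwork.

(** * How large a multiple of a pyramid the norm bound allows *)

Section BumpGain.
Variables (R : realType) (d B s l : nat) (q : \bar R) (c : R).
Hypotheses (s0 : (0 < s)%N) (sd : (s <= d)%N) (sB : (3 * s <= B)%N)
  (q1 : (1 <= q)%E) (c0 : 0 < c).

(** The gain [G] is uniform in center and radius, so a single value serves every pyramid of a
    grid. *)
Definition contains_bumps (G : R) := forall (h : R) (y : nat -> R),
  0 <= h <= 1 -> (forall i, (i < s)%N -> 0 <= y i <= 1) ->
  Hclass q d B l.+3 c (fun x => G * pyramid s h y x) /\
  Hclass q d B l.+3 c (fun x => - G * pyramid s h y x).

Let e := einv q.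

(* [r] copies of the first-layer units, [n] units in every later layer; [K]
   bounds the number of nonzero first-layer coefficients. *)
Lemma Hclass_scaled_bump (n r K : nat) : (0 < n <= B)%N -> (3 * r * s <= B)%N ->
  (3 * r * s <= K)%N -> (0 < K)%N ->
  contains_bumps (c ^+ l.+3 * n%:R `^ (1 - 2 * e) ^+ l.+1 * K%:R `^ (- (2 * e)) * r%:R).
Proof.
move=> /andP[n0 nB] rB rK K0 h y /andP[h0 h1] y01.
have pos k : 0 <= c * k%:R `^ (- e) by rewrite mulr_ge0 ?powR_ge0// ltW.
have cancel k : (0 < k)%N -> c * k%:R `^ (- e) * k%:R `^ e <= c.
  by move=> k0; rewrite powRN divfK// gt_eqF// powR_gt0// ltr0n.
have n0' : (n%:R : R) != 0 by rewrite pnatr_eq0 -lt0n.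
have K0' : (K%:R : R) != 0 by rewrite pnatr_eq0 -lt0n.
(* Every coefficient has the largest size permitted: [c] divided by the bound on its number of
   occurrences to the power [1 / q]. The output layer gives [n ^ (1 - e)] and the second layer
   [n ^ (- e)], which together make one more factor [n ^ (1 - 2 * e)] beside the [l] amplifying
   layers. *)
have E : c * n%:R `^ (- e) * n%:R * ((n%:R * (c * (n * n)%:R `^ (- e))) ^+ l *
    (c * K%:R `^ (- e) * (c * (n * K)%:R `^ (- e)) * r%:R)) =
  c ^+ l.+3 * n%:R `^ (1 - 2 * e) ^+ l.+1 * K%:R `^ (- (2 * e)) * r%:R.
  rewrite !natrM !powRM ?ler0n//.
  have -> : n%:R `^ (1 - 2 * e) = n%:R * n%:R `^ (- e) * n%:R `^ (- e).
    rewrite powRD ?n0' ?implybT// powRr1// -mulrA -powRD ?n0' ?implybT//.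
    by congr (_ * _ `^ _); ring.
  have -> : K%:R `^ (- (2 * e)) = K%:R `^ (- e) * K%:R `^ (- e).
    by rewrite -powRD ?K0' ?implybT//; congr (_ `^ _); ring.
  have -> : n%:R * (c * (n%:R `^ (- e) * n%:R `^ (- e))) =
    c * (n%:R * n%:R `^ (- e) * n%:R `^ (- e)) by ring.
  by rewrite (exprMn _ c) !exprS; ring.
rewrite -E; split.
  apply: (@Hclass_bump R d B s r n h _ _ _ (c * n%:R `^ (- e)) y s0 sd rB nB h0
    _ _ _ q c q1 _ h1 y01 K rK) => //; try (by apply: cancel; rewrite ?muln_gt0 ?n0);
    try exact: ltW.
  by rewrite ger0_norm ?pos//; exact: cancel.
rewrite -mulNr -mulNr.
apply: (@Hclass_bump R d B s r n h _ _ _ (- (c * n%:R `^ (- e))) y s0 sd rB nB h0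
    _ _ _ q c q1 _ h1 y01 K rK) => //; try (by apply: cancel; rewrite ?muln_gt0 ?n0);
    try exact: ltW.
by rewrite normrN ger0_norm ?pos//; exact: cancel.
Qed.

Let s0' : (0 : R) < s%:R. Proof. by rewrite ltr0n. Qed.

(** Take a single copy and a single unit per later layer: [n = r = 1], [K = 3 * s]. The resulting
    [s * G] is four times the required value. *)
Lemma contains_bumps_narrow : exists2 G : R,
  1 / (4 * 3 `^ (2 * e)) * c ^+ l.+3 * s%:R `^ (1 - 2 * e) <= s%:R * G &
  contains_bumps G.
Proof.
exists (c ^+ l.+3 * 1%:R `^ (1 - 2 * e) ^+ l.+1 * (3 * s)%:R `^ (- (2 * e)) * 1%:R);
  last first.
  by apply: Hclass_scaled_bump; rewrite ?muln1 ?muln_gt0//=; lia.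
rewrite powR1 expr1n !mulr1 natrM powRM// powRD; last first.
  by rewrite (gt_eqF s0') implybT.
rewrite powRr1 ?(ltW s0')// (powRN 3) (powRN s%:R).
rewrite (_ : 1 / (4 * 3 `^ (2 * e)) * c ^+ l.+3 * (s%:R / s%:R `^ (2 * e)) =
  4^-1 * (s%:R * (c ^+ l.+3 * ((3 `^ (2 * e))^-1 / s%:R `^ (2 * e))))).
  apply: ler_piMl; last lra.
  by do ?[exact: powR_ge0 | apply: exprn_ge0 | rewrite invr_ge0 | apply: mulr_ge0 | exact: ltW].
by field; rewrite !gt_eqF// powR_gt0.
Qed.

(** Use the full width: [n = K = B], with as many first-layer copies as fit, [r = B %/ (3 * s)]. *)
Lemma contains_bumps_wide : exists2 G : R,
  1 / 24 * c ^+ l.+3 * (B%:R `^ (1 - 2 * e)) ^+ l.+2 <= s%:R * G &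
  contains_bumps G.
Proof.
have B0 : (0 < B)%N by lia.
have rB : (B %/ (3 * s) * (3 * s) <= B)%N by exact: leq_divM.
exists (c ^+ l.+3 * B%:R `^ (1 - 2 * e) ^+ l.+1 * B%:R `^ (- (2 * e)) * (B %/ (3 * s))%:R);
  last first.
  by apply: Hclass_scaled_bump => //; rewrite ?B0 ?leqnn// -mulnA (mulnC _ s) mulnA mulnC.
have B0' : (B%:R : R) != 0 by rewrite pnatr_eq0 -lt0n.
rewrite [X in X <= _](_ : _ =
    c ^+ l.+3 * B%:R `^ (1 - 2 * e) ^+ l.+1 * B%:R `^ (- (2 * e)) * (24^-1 * B%:R)); last first.
  have E : B%:R `^ (1 - 2 * e) = B%:R * B%:R `^ (- (2 * e)) :> R.
    by rewrite powRD ?B0' ?implybT// powRr1.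
  by rewrite [_ ^+ l.+2]exprSr [in X in _ * (_ * X) = _]E; field.
rewrite [X in _ <= X]mulrCA; apply: ler_wpM2l.
  by do ?[exact: powR_ge0 | apply: exprn_ge0 | apply: mulr_ge0 | exact: ltW].
(* Since [r >= 1], rounding down costs at most a factor two: [B < 3 * s * (r + 1) <= 6 * s * r]. *)
have : (B <= 24 * (s * (B %/ (3 * s))))%N.
  have := ltn_ceil B (_ : 0 < 3 * s)%N; rewrite muln_gt0 s0 => /(_ isT).
  have : (0 < B %/ (3 * s))%N by rewrite divn_gt0 ?muln_gt0.
  by move: (B %/ (3 * s))%N => r r0; nia.
rewrite -(ler_nat R) !natrM; lra.
Qed.

End BumpGain.

(** * Geometry of the grid of pyramids *)

Section Pyramids.
Variables (R : realType) (d s : nat).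
Implicit Types (h : R) (y : nat -> R) (x : d.-tuple R).

Lemma pyramid_neq0 h y x : pyramid s h y x != 0 ->
  forall i, (i < s)%N -> `|x`_i - y i| < h.
Proof.
move=> px i si; rewrite ltNge; apply: contraNN px => hi.
rewrite /pyramid /relu; apply/eqP/max_l; rewrite subr_le0 (le_trans hi)//.
rewrite big_mkord (bigD1 (Ordinal si))//= lerDl.
by apply: sumr_ge0 => j _; exact: normr_ge0.
Qed.

Lemma pyramid_ge h y x : (0 < s)%N ->
  (forall i, (i < s)%N -> `|x`_i - y i| <= h / (2 * s%:R)) ->
  h / 2 <= pyramid s h y x.
Proof.
move=> s0 hx; rewrite /pyramid /relu le_max; apply/orP; right.
suff : \sum_(0 <= i < s) `|x`_i - y i| <= h / 2 by lra.
apply: (@le_trans _ _ (\sum_(0 <= i < s) h / (2 * s%:R))).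
  by apply: ler_sum_nat => i /andP[_]; exact: hx.
rewrite sumr_const_nat subn0 -(mulr_natr (h / _)) le_eqVlt; apply/orP; left.
by apply/eqP; field; rewrite pnatr_eq0 -lt0n.
Qed.

(** Coordinates are midpoints of the [k] equal subintervals of [0,1], so centers are labelled by a
    finite type of size [k ^ s]. The default 0 is reached only for [i >= s]. *)
Definition grid_point {k : nat} (l : s.-tuple 'I_k) (i : nat) : R :=
  (2 * (nth 0%N (map val l) i)%:R + 1) / (2 * k%:R).

Definition grid_radius (k : nat) : R := (2 * k%:R)^-1.

Lemma grid_point_bounds (k : nat) (l : s.-tuple 'I_k) (i : nat) : (i < s)%N ->
  grid_radius k <= grid_point l i <= 1 - grid_radius k.
Proof.
move=> si; rewrite /grid_point /grid_radius.
have [k0 ak] : (0 < k)%N /\ ((nth 0 (map val l) i).+1 <= k)%N.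
  rewrite (nth_map (tnth l (Ordinal si))) ?size_tuple//.
  by have := ltn_ord (nth (tnth l (Ordinal si)) l i); split=> //; lia.
move: ak; set a := nth _ _ _; rewrite -(ler_nat R) -natr1 => ak.
have k0' : 0 < 2 * k%:R :> R by rewrite mulr_gt0 ?ltr0n.
have a0 : 0 <= a%:R :> R by [].
rewrite ler_pdivlMr// mulVf ?gt_eqF// ler_pdivrMr// mulrBl mulVf ?gt_eqF//.
by apply/andP; split; lra.
Qed.

(** At a common point of two supports, corresponding center coordinates differ by less than [1 / k],
    the grid spacing, hence coincide. *)
Lemma pyramids_disjoint (k : nat) (l l' : s.-tuple 'I_k) x :
  pyramid s (grid_radius k) (grid_point l) x != 0 ->
  pyramid s (grid_radius k) (grid_point l') x != 0 -> l = l'.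
Proof.
move=> /pyramid_neq0 hl /pyramid_neq0 hl'.
apply/val_inj/(inj_map val_inj)/(@eq_from_nth _ 0%N).
  by rewrite !size_map !size_tuple.
move=> i; rewrite size_map size_tuple => si.
have k0 : (0 < k)%N.
  by have := ltn_ord (tnth l (Ordinal si)); lia.
have k0' : 0 < 2 * k%:R :> R by rewrite mulr_gt0 ?ltr0n.
have: `|grid_point l i - grid_point l' i| < 2 * grid_radius k.
  have := hl i si; have := hl' i si; rewrite !ltr_norml => /andP[? ?] /andP[? ?].
  by apply/andP; split; lra.
rewrite /grid_point /grid_radius -mulrBl normrM [`|_^-1|]gtr0_norm ?invr_gt0//.
rewrite ltr_pM2r ?invr_gt0// ltr_norml.
set a := nth _ _ _; set b := nth _ _ _ => /andP[h1 h2].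
have : (b < a.+1)%N by rewrite -(ltr_nat R) -natr1; lra.
have : (a < b.+1)%N by rewrite -(ltr_nat R) -natr1; lra.
by lia.
Qed.

End Pyramids.

(** * The L^p norm on the cube *)

Section LpNorm.
Variables (R : realType) (d : nat) (lam : {measure set (d.-tuple R) -> \bar R}).
Variable p : \bar R.
Hypothesis p1 : (1 <= p)%E.
Implicit Types (f g u : d.-tuple R -> R).

Lemma measurable_box (a b : d.-tuple R) :
  measurable [set x : d.-tuple R | forall i, tnth a i <= tnth x i <= tnth b i].
Proof.
rewrite (_ : [set _ | _] =
    \bigcap_(i in [set: 'I_d]) ((fun x => tnth x i) @^-1` `[tnth a i, tnth b i])).
  apply: fin_bigcap_measurable => [|i _]; first exact: finite_finset.
  rewrite -[X in measurable X]setTI.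
  exact: (measurable_tnth i measurableT (measurable_itv _)).
by apply/seteqP; split => x H i; have := H i; rewrite /= in_itv/= => // /(_ I).
Qed.

Lemma cubeE : @cube R d =
  [set x | forall i, tnth [tuple 0 | _ < d] i <= tnth x i <= tnth [tuple 1 | _ < d] i].
Proof. by apply/seteqP; split => x /= H i; have := H i; rewrite !tnth_mktuple. Qed.

Lemma measurable_cube : measurable (@cube R d).
Proof. by rewrite cubeE; exact: measurable_box. Qed.

Let measurable_mul_cube f : measurable_fun (@cube R d) f ->
  measurable_fun [set: d.-tuple R] (fun x => f x * \1_(@cube R d) x).
Proof.
move=> /(measurable_restrictT _ measurable_cube); congr measurable_fun.
by apply/funext => x; rewrite patchE indicE; case: ifP; rewrite ?mulr1 ?mulr0.
Qed.

Lemma Lpnorm_triangle u f g : Yset lam p u -> Yset lam p f -> Yset lam p g ->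
  (Lpnorm lam p (u \- g)%R <= Lpnorm lam p (u \- f)%R + Lpnorm lam p (f \- g)%R)%E.
Proof.
move=> [mu _] [mf _] [mg _]; rewrite /Lpnorm.
have E : (fun x => (u \- g)%R x * \1_(@cube R d) x) =
    ((fun x => (u \- f)%R x * \1_(@cube R d) x) \+
     (fun x => (f \- g)%R x * \1_(@cube R d) x))%R.
  by apply/funext => x /=; rewrite -mulrDl; congr (_ * _); ring.
rewrite (_ : (fun x => ((u \- g)%R x * _)%:E) = EFin \o
    ((fun x => (u \- f)%R x * \1_(@cube R d) x) \+
     (fun x => (f \- g)%R x * \1_(@cube R d) x))); last first.
  by rewrite -E.
by apply: eminkowski => //; apply: measurable_mul_cube; exact: measurable_funB.
Qed.

Lemma LpnormN f : Lpnorm lam p (\- f)%R = Lpnorm lam p f.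
Proof.
rewrite /Lpnorm -[RHS]oppe_Lnorm; apply: eq_Lnorm => x /=.
by rewrite mulNr EFinN.
Qed.

Lemma LpnormBC f g : Lpnorm lam p (f \- g)%R = Lpnorm lam p (g \- f)%R.
Proof. by rewrite -LpnormN; congr Lpnorm; apply/funext => x /=; rewrite opprB. Qed.

Lemma Lpnorm_ge0 f : (0 <= Lpnorm lam p f)%E.
Proof. exact: Lnorm_ge0. Qed.

(** Measurability of a method is given only through preimages of open sets; balls convert it into
    measurability of the error. *)
Lemma Yopen_ball u (r : R) : Yset lam p u ->
  Yopen lam p [set g | Yset lam p g /\ (Lpnorm lam p (u \- g)%R < r%:E)%E].
Proof.
move=> Yu; split => [g []//|f [Yf ufr]].
have uf_fin : Lpnorm lam p (u \- f)%R \is a fin_num.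
  by rewrite ge0_fin_numE ?Lpnorm_ge0// (lt_trans ufr)// ltry.
move: ufr; rewrite -(fineK uf_fin) lte_fin => ufr.
exists (r - fine (Lpnorm lam p (u \- f)%R)) => [|g Yg gf]; first by rewrite subr_gt0.
split=> //; apply: le_lt_trans (Lpnorm_triangle _ _ _ Yu Yf Yg) _.
by rewrite -(fineK uf_fin) addeC -lteBrDr// -EFinB LpnormBC.
Qed.

(** For finite [p] this is Chebyshev's inequality: the p-th power of the function dominates [t ^ p]
    times the indicator of [S]. For infinite [p], an essential supremum below [t] would put [S]
    inside a null set. *)
Lemma Lpnorm_lower_bound f (S : set (d.-tuple R)) (t v : R) :
  measurable_fun (@cube R d) f -> measurable S -> S `<=` @cube R d ->
  0 <= t -> 0 < v -> lam S = v%:E -> (forall x, S x -> t <= `|f x|) ->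
  ((t * v `^ einv p)%:E <= Lpnorm lam p f)%E.
Proof.
move=> mf mS Sc t0 v0 lS tf; have mF := measurable_mul_cube _ mf.
have tF x : S x -> t <= `|f x * \1_(@cube R d) x|.
  by move=> Sx; rewrite indicE mem_set ?mulr1 ?tf//; exact: Sc.
(* The L^oo norm is the essential supremum only when the total measure is positive. *)
have lT : (0 < lam setT)%E.
  apply: (@lt_le_trans _ _ (lam S)); first by rewrite lS lte_fin.
  by apply: le_measure; rewrite ?inE.
rewrite /Lpnorm unlock; case: p p1 => [r|_|//]; rewrite /einv; last first.
  rewrite lT powRr0 mulr1 leNgt; apply/negP => ess_t.
  have /ess_supP [N [mN N0 SN]] :=
    lexx (ess_sup lam (abse \o (fun x => (f x * \1_(cube d) x)%:E))).
  have : (lam S <= lam N)%E.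
    apply: le_measure; rewrite ?inE// => x Sx; apply: SN => /= h.
    have := le_lt_trans h ess_t; rewrite lte_fin ltNge tF//.
  by rewrite N0 lS lee_fin leNgt v0.
rewrite lee_fin => r1; have r0 : 0 < r by apply: lt_le_trans r1.
rewrite (_ : (t * v `^ r^-1)%:E = ((t `^ r * v)%:E `^ r^-1))%E; last first.
  rewrite poweR_EFin powRM ?powR_ge0 ?(ltW v0)// -powRrM mulfV ?gt_eqF// powRr1//.
apply: gt0_ler_poweR; rewrite ?invr_ge0 ?(ltW r0)//.
- by rewrite in_itv/= leey andbT lee_fin mulr_ge0 ?powR_ge0// ltW.
- rewrite in_itv/= leey andbT; apply: integral_ge0 => x _; rewrite lee_fin powR_ge0//.
rewrite EFinM -lS -[X in lam X]setIT -(integral_indic lam measurableT mS).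
rewrite -ge0_integralZl_EFin ?powR_ge0//;
  last exact/measurable_EFinP/measurable_indic.
apply: ge0_le_integral => //.
- by move=> x _; rewrite mule_ge0// lee_fin ?powR_ge0.
- by apply: measurable_funeM; exact/measurable_EFinP/measurable_indic.
- apply: (measurableT_comp (measurable_poweR r)).
  by apply: measurableT_comp => //; exact/measurable_EFinP.
- move=> x _; rewrite indicE; case: (boolP (x \in S)) => [/set_mem xS|_].
    rewrite mule1 /= lee_fin; apply: ge0_ler_powR; rewrite ?nnegrE ?(ltW r0)//.
    exact: tF.
  by rewrite mule0 poweR_ge0.
Qed.

End LpNorm.

(** The set is a box of half-side [h / (2 * s)] around [y] in the first [s] coordinates and all of
    [0,1] in the others. Summing [s] coordinate distances gives at most [h / 2]. *)
Lemma pyramid_core (R : realType) (d s : nat)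
    (lam : {measure set (d.-tuple R) -> \bar R}) (h : R) (y : nat -> R) :
  is_lebesgue lam -> (0 < s)%N -> (s <= d)%N -> 0 <= h ->
  (forall i, (i < s)%N -> h <= y i <= 1 - h) ->
  exists S : set (d.-tuple R), [/\ measurable S, S `<=` cube d,
    lam S = ((h / s%:R) ^+ s)%:E & forall x, S x -> h / 2 <= pyramid s h y x].
Proof.
move=> lebl s0 sd h0 yh.
pose rho := h / (2 * s%:R).
have s0' : 0 < s%:R :> R by rewrite ltr0n.
have rho0 : 0 <= rho by rewrite divr_ge0// mulr_ge0// ltW.
have rhoh : rho <= h.
  rewrite /rho ler_pdivrMr ?mulr_gt0// ler_peMr//.
  have : 1 <= s%:R :> R by rewrite ler1n.
  lra.
pose a := [tuple if (i < s)%N then y i - rho else 0 | i < d].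
pose b := [tuple if (i < s)%N then y i + rho else 1 | i < d].
have ab i : tnth a i <= tnth b i.
  by rewrite !tnth_mktuple; case: ifP => // _; lra.
exists [set x | forall i, tnth a i <= tnth x i <= tnth b i]; split.
- exact: measurable_box.
- move=> x abx i; have := abx i; rewrite !tnth_mktuple.
  case: ifP => [/yh|] // /andP[? ?] /andP[? ?].
  by apply/andP; split; lra.
- rewrite (lebl _ _ ab); congr (_%:E).
  transitivity (\prod_(i < d | (i < s)%N) (h / s%:R)).
    rewrite [RHS]big_mkcond; apply: eq_bigr => i _.
    rewrite !tnth_mktuple; case: ifP => _; last by rewrite subr0.
    by rewrite /rho; field; rewrite gt_eqF.
  by rewrite -(big_ord_widen _ (fun=> h / s%:R) sd) prodr_const card_ord.
- move=> x abx; apply: pyramid_ge => // i si.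
  have := abx (Ordinal (leq_trans si sd)); rewrite !tnth_mktuple /= si (tnth_nth 0) /=.
  rewrite -/rho ler_norml => /andP[? ?]; by apply/andP; split; lra.
Qed.

(** * Runs of an adaptive method and the labels they detect *)

Lemma hist_eq (R : realType) (d : nat) (next : seq (d.-tuple R * R) -> d.-tuple R)
    (u v : d.-tuple R -> R) (n : nat) :
  (forall z, z \in hist next u n -> v z.1 = u z.1) -> hist next v n = hist next u n.
Proof.
elim: n => //= n IH E.
rewrite IH; last by move=> z zh; apply: E; rewrite mem_rcons inE zh orbT.
have /= -> // := E (next (hist next u n), u (next (hist next u n))).
by rewrite mem_rcons inE eqxx.
Qed.

Lemma hist_cube (R : realType) (d : nat) (next : seq (d.-tuple R * R) -> d.-tuple R)
    (u : d.-tuple R -> R) (n : nat) : (forall g, cube d (next g)) ->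
  forall z, z \in hist next u n -> cube d z.1.
Proof.
move=> nc; elim: n => //= n IH z; rewrite mem_rcons inE => /orP[/eqP -> |/IH//]; exact: nc.
Qed.

Lemma size_hist (R : realType) (d : nat) (next : seq (d.-tuple R * R) -> d.-tuple R)
    (u : d.-tuple R -> R) (n : nat) : size (hist next u n) = n.
Proof. by elim: n => //= n IH; rewrite size_rcons IH. Qed.

(** By disjointness each sample point meets at most one label; a union bound over the samples
    concludes. *)
Lemma card_hit (T : finType) (X : eqType) (P : T -> X -> bool) (xs : seq X) :
  (forall x, x \in xs -> forall l l', P l x -> P l' x -> l = l') ->
  (#|[set l | has (P l) xs]%SET| <= size xs)%N.
Proof.
elim: xs => [|x xs IH] dis.
  by rewrite eq_card0// => l; rewrite !inE.
have -> : [set l | has (P l) (x :: xs)]%SET =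
    ([set l | P l x] :|: [set l | has (P l) xs])%SET by apply/setP => l; rewrite !inE.
apply: leq_trans (leq_card_setU _ _) _; rewrite /= -add1n leq_add//; last first.
  by apply: IH => x' xx'; apply: dis; rewrite inE xx' orbT.
rewrite leqNgt; apply/negP => /card_gt1P[l [l' []]]; rewrite !inE => Pl Pl' /eqP; apply.
exact: (dis x (mem_head _ _)).
Qed.

(** * From disjoint separated perturbations to a randomized lower bound *)

Section AveragedError.
Variables (R : realType) (d m : nat) (lam : {measure set (d.-tuple R) -> \bar R}).
Variables (p : \bar R) (U : set (d.-tuple R -> R)) (T : finType).
Variables (u0 : d.-tuple R -> R) (v : T -> bool -> d.-tuple R -> R) (delta : R).
Hypotheses (p1 : (1 <= p)%E) (m1 : (0 < m)%N) (mT : (2 * m <= #|T|)%N).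
Hypotheses (UY : forall u, U u -> Yset lam p u) (Uv : forall l b, U (v l b)).
Hypotheses (d0 : 0 <= delta).
Hypothesis disj : forall x, cube d x -> forall l l' b b',
  v l b x != u0 x -> v l' b' x != u0 x -> l = l'.
Hypothesis sep : forall l g, Yset lam p g -> exists b,
  (delta%:E <= Lpnorm lam p (v l b \- g)%R)%E.

(** For a label missed by the run along [u0], both signs reproduce that run and receive the same
    output, so [sep] yields a sign with error at least [delta]. At most [n] labels are hit. *)
Lemma few_samples_err (next : seq (d.-tuple R * R) -> d.-tuple R)
    (Q : seq (d.-tuple R * R) -> d.-tuple R -> R) (n : nat) :
  (forall g, cube d (next g)) -> (forall g, Yset lam p (Q g)) ->
  (#|T| <= n + \sum_(t : T * bool)
    (delta%:E <= Lpnorm lam p (v t.1 t.2 \- Q (hist next (v t.1 t.2) n))%R)%E)%N.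
Proof.
move=> nc QY; pose hit l (z : d.-tuple R * R) := [exists b, v l b z.1 != u0 z.1].
pose H := hist next u0 n.
have hitn : (#|[set l | has (hit l) H]%SET| <= n)%N.
  rewrite -[X in (_ <= X)%N](size_hist _ _ next u0 n); apply: card_hit.
  move=> z /hist_cube zc l l' /existsP[b hb] /existsP[b' hb'].
  by apply: disj hb hb'; exact: zc.
rewrite -(cardC [set l | has (hit l) H]%SET) leq_add// -sum1_card big_mkcond.
rewrite (_ : \sum_(t : T * bool) _ = \sum_(l : T) \sum_(b : bool)
   ((delta%:E <= Lpnorm lam p (v l b \- Q (hist next (v l b) n))%R)%E : nat))%N; last first.
  by rewrite pair_bigA.
apply: leq_sum => l _; rewrite !inE; case: ifPn => // /hasPn nhit.
have [b hb] := sep l _ (QY H).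
have Hb : hist next (v l b) n = H.
  apply: hist_eq => z /nhit; rewrite negb_exists => /forallP/(_ b).
  by rewrite negbK => /eqP.
by rewrite (bigD1 b)//= Hb hb.
Qed.

(** If every expected error were below [delta / 4], Markov's inequality would make each of the
    [2 * #|T|] events of error at least [delta] have probability below 1/4. Integrating
    [few_samples_err] would then give [#|T| < m + #|T| / 2], against [2 * m <= #|T|]. *)
Lemma errMC_ge : ((delta / 4)%:E <= errMC lam p U m)%E.
Proof.
apply: le_ereal_inf_tmp => e [dO [Om [P [next [Q [mm [mmm [Emm [_ [nc [QY [mQ ->]]]]]]]]]]]].
rewrite leNgt; apply/negP => sup_lt.
pose f (t : T * bool) w :=
  Lpnorm lam p (v t.1 t.2 \- Q w (hist (next w) (v t.1 t.2) (mm w)))%R.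
pose E (r : R) t := [set w | (r%:E <= f t w)%E].
(* The complement is the preimage of an open ball of radius [r] around the target function. *)
have mE r t : measurable (E r t).
  rewrite -[E r t]setCK; apply: measurableC.
  have := mQ _ (Uv t.1 t.2) _ (Yopen_ball _ _ _ _ p1 _ r (UY _ (Uv t.1 t.2))).
  congr measurable; apply/seteqP; split => w /=.
    by move=> [_]; rewrite ltNge => /negP.
  by move=> /negP; rewrite -ltNge; split.
have mf t : measurable_fun [set: Om] (f t).
  apply: (measurability _ (ErealGenCInfty.measurableE R)) => A [_ [r ->] <-].
  rewrite setTI; have := mE r t; congr measurable.
  by apply/seteqP; split => w; rewrite /= in_itv/= ?leey ?andbT.
have PE t : (P (E delta t) < (4^-1)%:E)%E.
  have ft : (\int[P]_w f t w < (delta / 4)%:E)%E.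
    apply: le_lt_trans sup_lt; apply: ereal_sup_ubound.
    by exists (v t.1 t.2).
  (* A nonnegative integral strictly below [delta / 4] excludes [delta = 0], so [delta] can be
     cancelled in Markov's inequality. *)
  have d_gt0 : 0 < delta.
    rewrite lt_neqAle d0 andbT; apply: contraTN ft => /eqP <-.
    rewrite mul0r -leNgt; apply: integral_ge0 => w _; exact: Lpnorm_ge0.
  rewrite -(lte_pmul2l (_ : delta%:E \is a fin_num) _)//.
  rewrite -EFinM; apply: le_lt_trans ft.
  rewrite -[X in P X]setIT -(integral_indic P measurableT (mE delta t)).
  rewrite -ge0_integralZl_EFin//; last exact/measurable_EFinP/measurable_indic.
  apply: ge0_le_integral => //.
  - by move=> w _; rewrite mule_ge0// lee_fin.
  - by apply: measurable_funeM; exact/measurable_EFinP/measurable_indic.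
  - move=> w _; rewrite indicE; case: (boolP (w \in E delta t)) => [/set_mem|_].
      by rewrite mule1.
    by rewrite mule0 Lpnorm_ge0.
have mmE : measurable_fun [set: Om] (fun w => ((mm w)%:R)%:E : \bar R).
  exact/measurable_EFinP/(measurableT_comp (f := fun n : nat => n%:R : R)).
(* The counting bound holds for each [w] with its own sample number [mm w]; after integration only
   the mean of [mm] matters. *)
have : (#|T|%:R%:E <= \int[P]_w (((mm w)%:R)%:E + \sum_t (\1_(E delta t) w)%:E))%E.
  rewrite -[X in (X <= _)%E]mule1 -(@probability_setT _ _ _ P) -integral_cst//.
  apply: ge0_le_integral => //.
  - by move=> w _; rewrite /= lee_fin.
  - apply: emeasurable_funD => //; apply: emeasurable_sum => t.
    exact/measurable_EFinP/measurable_indic.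
  - move=> w _; rewrite sumEFin -EFinD lee_fin.
    have := few_samples_err (next w) (Q w) (mm w) (nc w) (QY w).
    rewrite -(ler_nat R) natrD natr_sum => /le_trans; apply.
    rewrite lerD2l; apply: ler_sum => t _; rewrite indicE.
    by case: (boolP (delta%:E <= _)%E) => // h; rewrite mem_set.
rewrite ge0_integralD//; last 2 first.
- by move=> w _; apply: sume_ge0.
- apply: emeasurable_sum => t; exact/measurable_EFinP/measurable_indic.
rewrite ge0_integral_sum//; last first.
  by move=> t; exact/measurable_EFinP/measurable_indic.
move=> Tle.
have : (#|T|%:R%:E <= m%:R%:E + \sum_(t : T * bool) P (E delta t))%E.
  apply: le_trans Tle _; apply: leeD => //; apply: lee_sum => t _.
  by rewrite integral_indic// setIT.

have PEfin t : P (E delta t) \is a fin_num by exact: fin_num_measure.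
under eq_bigr do rewrite -(fineK (PEfin _)).
rewrite sumEFin -EFinD lee_fin => Tle2.
have : \sum_(t : T * bool) fine (P (E delta t)) < \sum_(t : T * bool) (4^-1 : R).
  have T0 : (0 < #|T|)%N by lia.
  have [l0 _] := card_gt0P T0.
  apply: ltr_sum => [|t _]; first by apply/hasP; exists (l0, true).
  by rewrite -lte_fin fineK.
rewrite sumr_const card_prod card_bool -(mulr_natr 4^-1) natrM => lt_sum.
have : (2 * m)%:R <= #|T|%:R :> R by rewrite ler_nat.
rewrite natrM; lra.
Qed.
End AveragedError.

(** * Grid size, rate and assembly *)

Lemma exists_grid_size (m s : nat) : (0 < m)%N -> (0 < s)%N ->
  exists k, [/\ (0 < k)%N, (2 * m <= k ^ s)%N & ((2 * k) ^ s <= 8 ^ s * m)%N].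
Proof.
move=> m0 s0.
have ex : exists k, (2 * m <= k ^ s)%N.
  by exists (2 * m)%N; rewrite -{1}[(2 * m)%N]expn1 leq_pexp2l// muln_gt0.
(* For the least such [k], minimality gives [(k - 1) ^ s < 2 * m], and [k >= 2] gives
   [k <= 2 * (k - 1)]. One factor 2 in [8 = 2 * 2 * 2] comes from [2 * k], one from this doubling,
   and one absorbs the 2 of [2 * m]. *)
case: (ex_minnP ex) => k mk mink.
have k0 : (0 < k)%N by case: k mk {mink} => //; rewrite exp0n//; lia.
exists k; split => //.
have k1 : (1 < k)%N.
  by case: k k0 mk {mink} => [|[|k]]//; rewrite exp1n; lia.
have hk : (k.-1 ^ s < 2 * m)%N.
  by rewrite ltnNge; apply/negP => /mink; lia.
have kk : (k ^ s <= 2 ^ s * k.-1 ^ s)%N by rewrite -expnMn leq_exp2r//; lia.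
have s2 : (2 <= 2 ^ s)%N by rewrite -{1}[2%N]expn1 leq_pexp2l.
rewrite expnMn (_ : 8 = 2 * (2 * 2))%N// !expnMn -!mulnA leq_mul2l; apply/orP; right.
apply: leq_trans kk _; rewrite leq_mul2l; apply/orP; right.
by apply: leq_trans (ltnW hk) _; rewrite leq_mul2r s2 orbT.
Qed.

(** Here [ep] stands for [1 / p]. The grid condition gives radius at least [1 / (8 * m ^ (1 / s))],
    which bounds both the height and the volume of a pyramid core from below. *)
Lemma rate_le (R : realType) (c0 Om G ep : R) (m s k : nat) :
  (0 < m)%N -> (0 < s)%N -> (0 < k)%N -> 0 <= c0 -> 0 <= Om -> 0 <= ep ->
  Om <= s%:R * G -> ((2 * k) ^ s <= 8 ^ s * m)%N ->
  c0 * (Om / (64 * s%:R) `^ (1 + s%:R * ep)) * m%:R `^ (- ep - s%:R^-1) <=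
  c0 * G * grid_radius R k * ((grid_radius R k / s%:R) ^+ s) `^ ep / 2 / 4.
Proof.
move=> m0 s0 k0 c00 Om0 ep0 OmG Mk.
have m0' : 0 < m%:R :> R by rewrite ltr0n.
have s0' : 0 < s%:R :> R by rewrite ltr0n.
have k0' : 0 < k%:R :> R by rewrite ltr0n.
have Mk' : (2 * k%:R) ^+ s <= 8 ^+ s * m%:R :> R.
  by move: Mk; rewrite -(ler_nat R) !(natrM, natrX).
have M8 : 2 * k%:R <= 8 * m%:R `^ s%:R^-1 :> R.
  rewrite -(@ler_pXn2r _ s)// ?nnegrE ?mulr_ge0 ?powR_ge0//.
  suff -> : (8 * m%:R `^ s%:R^-1) ^+ s = 8 ^+ s * m%:R :> R by [].
  rewrite exprMn -(powR_mulrn _ (powR_ge0 m%:R s%:R^-1)).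
  by rewrite -powRrM mulVf ?gt_eqF// powRr1.
have rad : (8 * m%:R `^ s%:R^-1)^-1 <= grid_radius R k.
  by rewrite /grid_radius lef_pV2 ?posrE ?mulr_gt0 ?powR_gt0.
have rs0 : 0 < grid_radius R k / s%:R by rewrite divr_gt0// invr_gt0 mulr_gt0.
have vol : ((8 * s%:R) `^ (s%:R * ep) * m%:R `^ ep)^-1 <=
    ((grid_radius R k / s%:R) ^+ s) `^ ep.
  have -> : (8 * s%:R) `^ (s%:R * ep) * m%:R `^ ep = ((8 * s%:R) ^+ s * m%:R) `^ ep.
    by rewrite powRrM powR_mulrn ?mulr_ge0// powRM// exprn_ge0 ?mulr_ge0.
  have Z0 : 0 < (2 * k%:R * s%:R) ^+ s :> R by rewrite exprn_gt0 ?mulr_gt0.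
  have -> : ((grid_radius R k / s%:R) ^+ s) `^ ep = (((2 * k%:R * s%:R) ^+ s) `^ ep)^-1.
    apply: (mulIf (x := ((2 * k%:R * s%:R) ^+ s) `^ ep)); first by rewrite gt_eqF ?powR_gt0.
    rewrite mulVf ?gt_eqF ?powR_gt0// -powRM ?(ltW Z0) ?exprn_ge0 ?(ltW rs0)//.
    rewrite -exprMn /grid_radius (_ : _ * _ = 1) ?expr1n ?powR1//.
    by field; rewrite !gt_eqF.
  rewrite lef_pV2 ?posrE ?powR_gt0 ?mulr_gt0 ?exprn_gt0 ?mulr_gt0//.
  apply: ge0_ler_powR; rewrite ?nnegrE ?(ltW Z0) ?mulr_ge0 ?exprn_ge0 ?mulr_ge0//.
  by rewrite (exprMn _ (2 * k%:R)) (exprMn _ 8) [X in _ <= X]mulrAC ler_pM2r ?exprn_gt0.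
have big : (8 * s%:R) `^ (s%:R * ep) <= (64 * s%:R) `^ (s%:R * ep) :> R.
  apply: ge0_ler_powR; rewrite ?nnegrE ?mulr_ge0 ?(ltW s0')//.
  by rewrite ler_pM2r// ler_nat.
(* The linear factor 64 is [8 * 8]: one 8 from the radius, the other from the final division by 2
   and by 4. In the volume factor, 8 is merely enlarged to 64. *)
have -> : c0 * (Om / (64 * s%:R) `^ (1 + s%:R * ep)) * m%:R `^ (- ep - s%:R^-1) =
    c0 * (Om / s%:R) * (8 * m%:R `^ s%:R^-1)^-1 *
    ((64 * s%:R) `^ (s%:R * ep) * m%:R `^ ep)^-1 / 8.
  rewrite !powRD ?(gt_eqF m0') ?(gt_eqF (mulr_gt0 _ s0')) ?implybT//.
  rewrite powRr1 ?mulr_ge0// !powRN.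
  field; rewrite ?gt_eqF ?powR_gt0 ?mulr_gt0//.
have -> : c0 * G * grid_radius R k * ((grid_radius R k / s%:R) ^+ s) `^ ep / 2 / 4 =
  c0 * G * grid_radius R k * ((grid_radius R k / s%:R) ^+ s) `^ ep / 8 by field.
rewrite ler_pM2r ?invr_gt0//.
have OG : Om / s%:R <= G by rewrite ler_pdivrMr// mulrC.
apply: ler_pM; rewrite ?invr_ge0 ?mulr_ge0 ?invr_ge0 ?mulr_ge0 ?powR_ge0//; last first.
  apply: le_trans vol; rewrite lef_pV2 ?posrE ?mulr_gt0 ?powR_gt0 ?mulr_gt0//.
  by rewrite ler_pM2r ?powR_gt0.
apply: ler_pM; rewrite ?invr_ge0 ?mulr_ge0 ?invr_ge0 ?powR_ge0//.
by apply: ler_wpM2l.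
Qed.

(** Both regimes of [q] share this argument; they differ only in the gain [G] and in the constant
    [Om] below [s * G]. *)
Lemma pyramids_lower_bound (R : realType) (L d B : nat) (p q : \bar R) (c c0 : R)
  (lam : {measure set (d.-tuple R) -> \bar R})
  (U : set (d.-tuple R -> R)) (m s : nat) (G Om : R) :
  (1 <= p)%E -> 0 < c0 -> is_lebesgue lam ->
  (forall u, U u -> Yset lam p u) ->
  (exists2 u0, U u0 & forall f, Hclass q d B L.+3 c f ->
     exists2 v, U v & forall x, cube d x -> v x = u0 x + c0 * f x) ->
  (1 <= m)%N -> (1 <= s)%N -> (s <= d)%N -> 0 <= Om ->
  Om <= s%:R * G -> contains_bumps R d B s L q c G ->
  ((c0 * (Om / ((64 * s%:R) `^ (1 + s%:R * einv p)))
       * (m%:R `^ (- einv p - s%:R^-1)))%:E <= errMC lam p U m)%E.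
Proof.
move=> p1 c00 lebl UY [u0 Uu0 Hu0] m1 s1 sd Om0 OmG bumps.
have [k [k0 mk kM]] := exists_grid_size m s m1 s1.
have s0' : 0 < s%:R :> R by rewrite ltr0n.
have G0 : 0 <= G by rewrite -(pmulr_rge0 _ s0') (le_trans Om0).
have rk0 : 0 < grid_radius R k by rewrite invr_gt0 mulr_gt0 ?ltr0n.
have rk1 : grid_radius R k <= 1.
  by rewrite invf_le1 ?mulr_gt0 ?ltr0n// -natrM ler1n muln_gt0.
pose pyr (l : s.-tuple 'I_k) :=
  pyramid s (grid_radius R k) (grid_point R s l) : d.-tuple R -> R.
(* One member of [U] is fixed for each signed pyramid, the boolean being the exponent of the sign;
   its values are prescribed only on the cube. *)
have /choice[v vP] : forall t : s.-tuple 'I_k * bool, exists v, U v /\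
    forall x, cube d x -> v x = u0 x + c0 * ((-1) ^+ t.2 * G * pyr t.1 x).
  move=> [l b]; have [|i si|H1 H2] := bumps (grid_radius R k) (grid_point R s l).
  - by rewrite (ltW rk0).
  - have /andP[? ?] := grid_point_bounds R s k l i si.
    by apply/andP; split; [apply: le_trans (ltW rk0) _|]; lra.
  - have [] := Hu0 (fun x => (-1) ^+ b * G * pyr l x).
      by case: b; rewrite /= ?expr1 ?expr0 ?mulN1r ?mul1r.
    by move=> w Uw wE; exists w.
apply: (@le_trans _ _
  (c0 * G * grid_radius R k * ((grid_radius R k / s%:R) ^+ s) `^ einv p / 2 / 4)%:E).
  by rewrite lee_fin; apply: rate_le => //; [exact: ltW|exact: einv_ge0].
apply: (@errMC_ge R d m lam p U _ u0 (fun l b => v (l, b))) => //.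
- by rewrite card_tuple card_ord.
- by move=> l b; have [] := vP (l, b).
- by rewrite !mulr_ge0 ?powR_ge0 ?(ltW c00) ?(ltW rk0).
- move=> x cx l l' b b'; have [_ /(_ x cx) ->] := vP (l, b).
  have [_ /(_ x cx) ->] := vP (l', b').
  move=> /= h h'; apply: (pyramids_disjoint R d s k l l' x).
    by apply: contra h => /eqP pl; rewrite /pyr pl !mulr0 addr0.
  by apply: contra h' => /eqP pl; rewrite /pyr pl !mulr0 addr0.
- move=> l g Yg.
  have [S [mS Sc lS HS]] := pyramid_core R d s lam (grid_radius R k) (grid_point R s l)
    lebl s1 sd (ltW rk0) (grid_point_bounds R s k l).
  set delta := _ / 2; set v0 := v (l, false); set v1 := v (l, true).
  have [Uv0 v0E] := vP (l, false); have [Uv1 v1E] := vP (l, true).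
  have Y0 := UY _ Uv0; have Y1 := UY _ Uv1.
  (* The two signs differ by [2 * c0 * G] times a pyramid that is at least half its radius on [S].
     The division by 2 in [delta] is the share left to one of them by the triangle inequality. *)
  have far : ((delta + delta)%:E <= Lpnorm lam p (v0 \- v1)%R)%E.
    have := @Lpnorm_lower_bound R d lam p p1 (v0 \- v1)%R S (c0 * G * grid_radius R k)
      ((grid_radius R k / s%:R) ^+ s).
    have -> : delta + delta =
        c0 * G * grid_radius R k * ((grid_radius R k / s%:R) ^+ s) `^ einv p.
      by rewrite /delta; field.
    apply => //.
    + by apply: measurable_funB; [have [] := Y0|have [] := Y1].
    + by rewrite !mulr_ge0 ?(ltW c00) ?(ltW rk0).
    + by rewrite exprn_gt0// divr_gt0.
    + move=> x Sx; rewrite /= /v0 /v1 v0E ?v1E; try exact: Sc.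
      rewrite /= expr0 expr1 mul1r mulN1r.
      have := HS x Sx; rewrite -/(pyr l x) => hx.
      rewrite (_ : _ - _ = c0 * G * (2 * pyr l x)); last by ring.
      rewrite ger0_norm; last by rewrite !mulr_ge0 ?(ltW c00)//; lra.
      by apply: ler_wpM2l; [rewrite mulr_ge0 ?(ltW c00)|lra].
  have tri := le_trans far (Lpnorm_triangle R d lam p p1 v0 g v1 Y0 Yg Y1).
  have [h|h] := leP delta%:E (Lpnorm lam p (v0 \- g)%R); first by exists false.
  exists true; rewrite LpnormBC leNgt; apply/negP => h'.
  by have := lt_le_trans (lteD h h') tri; rewrite ltxx.
Qed.

Theorem theorem2p2 (R : realType) (L d B : nat) (p q : \bar R) (c c0 : R)
  (lam : {measure set (d.-tuple R) -> \bar R})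
  (U : set (d.-tuple R -> R)) (m s : nat) :
  (3 <= L)%N ->
  (1 <= p)%E -> (1 <= q)%E -> 0 < c -> 0 < c0 ->
  is_lebesgue lam ->
  (forall u, U u -> cont_on_cube u /\ Yset lam p u) ->
  (exists2 u0, U u0 & forall f, Hclass q d B L c f ->
     exists2 v, U v & forall x, cube d x -> v x = u0 x + c0 * f x) ->
  (1 <= m)%N -> (1 <= s)%N -> (3 * s <= B)%N -> (s <= d)%N ->
  let bnd (Om : R) :=
    c0 * (Om / ((64 * s%:R) `^ (1 + s%:R * einv p)))
       * (m%:R `^ (- einv p - s%:R^-1)) in
  ((q <= 2%:E)%E ->
     (bnd (1 / (4 * 3 `^ (2 * einv q)) * c ^+ L * s%:R `^ (1 - 2 * einv q)))%:E
       <= errMC lam p U m)%E /\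
  ((2%:E <= q)%E ->
     (bnd (1 / 24 * c ^+ L * (B%:R `^ (1 - 2 * einv q)) ^+ (L - 1)))%:E
       <= errMC lam p U m)%E.
Proof.
(* Two layers build the pyramid and one reads it out; the remaining [L] layers amplify. *)
case: L => [|[|[|L]]]// _ p1 q1 cpos c0pos lebl UY Hu m1 s1 sB sd bnd.
split=> _.
  have [G OmG bumps] := contains_bumps_narrow R d B s L q c s1 sd sB q1 cpos.
  apply: pyramids_lower_bound OmG bumps => //; first by move=> u /UY[].
  by do ?[exact: powR_ge0 | apply: exprn_ge0 | apply: divr_ge0 | apply: mulr_ge0 | exact: ltW].
have [G OmG bumps] := contains_bumps_wide R d B s L q c s1 sd sB q1 cpos.
rewrite subn1; apply: pyramids_lower_bound OmG bumps => //; first by move=> u /UY[].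
by do ?[exact: powR_ge0 | apply: exprn_ge0 | apply: divr_ge0 | apply: mulr_ge0 | exact: ltW].
Qed.
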